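(* Let $k\geq 2$ be an integer, let $x_0,\dots,x_{k-1},a_1,\dots,a_k\in\mathbb{Z}$, and let $(x_n)_{n\geq 0}$ be the linear recurrence of order $k$ with initial values $x_0,\dots,x_{k-1}$ satisfying $$x_n=a_1x_{n-1}+\dots+a_kx_{n-k}$$ for all integers $n\geq k$. If $p$ is a prime such that $p\nmid a_k$ and $$\min\{\nu_p(a_j):1\leq j<k\}>\max\{\nu_p(x_m)-\nu_p(x_n):0\leq m,n<k\},$$ then the quotient set $R((x_n)_{n\geq 0})$ is not dense in $\mathbb{Q}_p$.
   Context: For a set of integers $A$, the quotient set (ratio set) of $A$ is $R(A)=\{a/b : a,b\in A,\ b\neq 0\}$; for a sequence $(x_n)_{n\ge 0}$ of integers, its quotient set $R((x_n)_{n\ge0})$ is $R(\{x_n : n\geq 0\})$. $\mathbb{Q}_p$ is the field of $p$-adic numbers, and denseness is with respect to the $p$-adic metric, with $R(A)\subset\mathbb{Q}\subset\mathbb{Q}_p$. $\nu_p$ denotes the $p$-adic valuation, with the convention $\nu_p(0)=\infty$. The displayed inequality is between extended values: the left side may be $\infty$ (when $a_1=\dots=a_{k-1}=0$), and the inequality is understood not to hold if some initial value $x_i$ ($0\le i<k$) is $0$, since then the right side is $\infty$ or undefined. *)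

(* Defs.v *)
From HB Require Import structures.
From mathcomp Require Import all_boot all_order all_algebra.
From mathcomp Require Import ring_quotient generic_quotient.
From mathcomp Require Import all_classical all_reals topology.
From mathcomp Require Import normedtype sequences.

Set Implicit Arguments.
Unset Strict Implicit.
Unset Printing Implicit Defensive.

Import Order.TTheory GRing.Theory Num.Theory.
Import numFieldNormedType.Exports.

Local Open Scope classical_set_scope.
Local Open Scope quotient_scope.
Local Open Scope ring_scope.

(* When [p] is not prime, [logn p] is identically 0: [padic_abs p] is then the
   trivial absolute value, still an absolute value, so that the construction
   below needs no proof that [p] is prime. *)
Definition padic_val (p : nat) (q : rat) : \bar int :=
  if q == 0 then +oo%E
  else ((logn p `|numq q|)%:Z - (logn p `|denq q|)%:Z)%:E.

Definition padic_abs (p : nat) (q : rat) : rat :=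
  if padic_val p q is v%:E then p%:R ^ (- v) else 0.

Section PadicAbs.
Variable p : nat.
Implicit Types (q r : rat) (a b d : int).

Let logn_nprime n : ~~ prime p -> logn p n = 0%N.
Proof. by move=> np; rewrite lognE (negPf np). Qed.

Let c : rat := if prime p then p%:R else 1.

Let c_ge1 : 1 <= c.
Proof.
by rewrite /c; case: ifP => // pp; rewrite (ler_nat rat 1) prime_gt0.
Qed.

Let c_gt0 : 0 < c. Proof. exact: lt_le_trans c_ge1. Qed.

Let cX_neq0 n : c ^+ n != 0. Proof. by rewrite expf_neq0 ?gt_eqF. Qed.

Let padic_absE q : q != 0 ->
  padic_abs p q = c ^+ logn p `|denq q| / c ^+ logn p `|numq q|.
Proof.
move=> q0; rewrite /padic_abs /padic_val (negPf q0) /c.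
have [pp|np] := boolP (prime p); last first.
  by rewrite !logn_nprime // subrr oppr0 expr0z !expr0 divr1.
by rewrite opprB expfzDr ?pnatr_eq0 -?lt0n ?prime_gt0 // -exprnN -exprnP.
Qed.

Lemma padic_abs0 : padic_abs p 0 = 0.
Proof. by rewrite /padic_abs /padic_val eqxx. Qed.

Lemma padic_abs_gt0 q : q != 0 -> 0 < padic_abs p q.
Proof. by move=> q0; rewrite padic_absE // divr_gt0 ?exprn_gt0. Qed.

Lemma padic_abs_ge0 q : 0 <= padic_abs p q.
Proof.
by have [->|/padic_abs_gt0/ltW//] := eqVneq q 0; rewrite padic_abs0.
Qed.

Lemma padic_abs_eq0 q : (padic_abs p q == 0) = (q == 0).
Proof.
have [->|q0] := eqVneq q 0; first by rewrite padic_abs0 eqxx.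
by rewrite gt_eqF ?padic_abs_gt0.
Qed.

Lemma padic_abs_frac a d : a != 0 -> d != 0 ->
  padic_abs p (a%:Q / d%:Q) = c ^+ logn p `|d| / c ^+ logn p `|a|.
Proof.
move=> a0 d0; set q := a%:Q / d%:Q.
have dQ : d%:Q != 0 by rewrite intr_eq0.
have q0 : q != 0 by rewrite mulf_neq0 ?invr_eq0 ?intr_eq0.
have n0 : numq q != 0 by rewrite numq_eq0.
have e : numq q * d = a * denq q.
  apply/eqP; rewrite -(eqr_int rat) !intrM.
  have -> : a%:Q = q * d%:Q by rewrite /q divfK.
  by rewrite numqE mulrAC.
rewrite padic_absE //; apply/eqP.
rewrite eqr_div // -!exprD -!lognM ?absz_gt0 ?denq_neq0 //.
by rewrite -!abszM [denq q * a]mulrC -e mulrC.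
Qed.

Let fracP q r : exists a b d, [/\ d != 0, q = a%:Q / d%:Q & r = b%:Q / d%:Q].
Proof.
exists (numq q * denq r), (numq r * denq q), (denq q * denq r).
have [qd rd] : (denq q)%:Q != 0 /\ (denq r)%:Q != 0.
  by rewrite !intr_eq0 !denq_neq0.
split; first by rewrite mulf_neq0 ?denq_neq0.
- by rewrite !intrM -mulf_div divff // mulr1 divq_num_den.
- by rewrite !intrM [X in _ / X]mulrC -mulf_div divff // mulr1 divq_num_den.
Qed.

Lemma padic_absM q r : padic_abs p (q * r) = padic_abs p q * padic_abs p r.
Proof.
have [->|q0] := eqVneq q 0; first by rewrite mul0r padic_abs0 mul0r.
have [->|r0] := eqVneq r 0; first by rewrite mulr0 padic_abs0 mulr0.
rewrite -{1}(divq_num_den q) -{1}(divq_num_den r) mulf_div -!intrM.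
rewrite padic_abs_frac ?mulf_neq0 ?numq_eq0 ?denq_neq0 // !padic_absE //.
by rewrite !abszM !lognM ?absz_gt0 ?numq_eq0 ?denq_neq0 // !exprD mulf_div.
Qed.

Lemma padic_abs1 : padic_abs p 1 = 1.
Proof. by rewrite padic_absE ?oner_eq0 // logn1 expr0 divr1. Qed.

Lemma padic_absN q : padic_abs p (- q) = padic_abs p q.
Proof. by rewrite /padic_abs /padic_val oppr_eq0 numqN denqN abszN. Qed.

Lemma padic_absV q : padic_abs p q^-1 = (padic_abs p q)^-1.
Proof.
have [->|q0] := eqVneq q 0; first by rewrite ?(padic_abs0, invr0).
have a0 : padic_abs p q != 0 by rewrite padic_abs_eq0.
by apply: (mulfI a0); rewrite -padic_absM !divff ?padic_abs1.
Qed.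

Lemma padic_absB q r : padic_abs p (q - r) = padic_abs p (r - q).
Proof. by rewrite -padic_absN opprB. Qed.

Lemma padic_abs_ultra q r :
  padic_abs p (q + r) <= Num.max (padic_abs p q) (padic_abs p r).
Proof.
have [->|q0] := eqVneq q 0; first by rewrite add0r le_max lexx orbT.
have [->|r0] := eqVneq r 0; first by rewrite addr0 le_max lexx.
have [->|s0] := eqVneq (q + r) 0; first by rewrite padic_abs0 le_max padic_abs_ge0.
have [a [b [d [d0 qE rE]]]] := fracP q r.
have a0 : a != 0 by apply: contraNneq q0 => a0; rewrite qE a0 mul0r.
have b0 : b != 0 by apply: contraNneq r0 => b0; rewrite rE b0 mul0r.
have sE : q + r = (a + b)%:Q / d%:Q by rewrite qE rE -mulrDl intrD.
have ab0 : a + b != 0 by apply: contraNneq s0 => ab0; rewrite sE ab0 mul0r.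
rewrite sE qE rE !padic_abs_frac //.
have H : (minn (logn p `|a|) (logn p `|b|) <= logn p `|(a + b)%R|)%N.
  have [pp|np] := boolP (prime p); last by rewrite !logn_nprime.
  rewrite -pfactor_dvdn ?absz_gt0 //.
  have: ((p ^ minn (logn p `|a|) (logn p `|b|))%N%:Z %| a + b)%Z.
    by apply: rpredD; rewrite ?dvdzE /= pfactor_dvdn ?absz_gt0 // geq_min
       leqnn ?orbT.
  by rewrite dvdzE.
have L m : (m <= logn p `|(a + b)%R|)%N ->
    c ^+ logn p `|d| / c ^+ logn p `|(a + b)%R| <= c ^+ logn p `|d| / c ^+ m.
  move=> mle; rewrite ler_pM2l ?exprn_gt0 // lef_pV2 ?posrE ?exprn_gt0 //.
  exact: ler_weXn2l.
rewrite le_max; move: H; rewrite geq_min => /orP[|] /L -> //; exact: orbT.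
Qed.

Lemma padic_abs_ultra_lt q r e :
  padic_abs p q < e -> padic_abs p r < e -> padic_abs p (q + r) < e.
Proof.
by move=> qe re; rewrite (le_lt_trans (padic_abs_ultra _ _)) // gt_max qe.
Qed.

(* every triangle is isosceles *)
Lemma padic_abs_isosceles q r :
  padic_abs p (q - r) < padic_abs p r -> padic_abs p q = padic_abs p r.
Proof.
move=> qr; apply/eqP; rewrite eq_le; apply/andP; split.
  rewrite -(subrK r q) (le_trans (padic_abs_ultra _ _)) // ge_max lexx andbT.
  exact: ltW.
rewrite leNgt; apply/negP => rq.
have : padic_abs p (q - (q - r)) < padic_abs p r.
  by apply: padic_abs_ultra_lt => //; rewrite padic_absN.
by rewrite subKr ltxx.
Qed.

End PadicAbs.

Definition padic_cauchy (p : nat) (u : nat -> rat) : Prop :=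
  forall e : rat, 0 < e -> exists N : nat, forall m n : nat,
    (N <= m)%N -> (N <= n)%N -> padic_abs p (u m - u n) < e.

Definition padic_cauchyb (p : nat) : pred (nat -> rat) :=
  fun u => `[< padic_cauchy p u >].

Lemma padic_cauchy_bounded p u : padic_cauchy p u ->
  exists B N, 0 < B /\ forall n, (N <= n)%N -> padic_abs p (u n) < B.
Proof.
move=> /(_ 1 ltr01)[N uN]; exists (padic_abs p (u N) + 1), N; split.
  by rewrite ltr_wpDl ?padic_abs_ge0.
move=> n Nn; rewrite -(subrK (u N) (u n)).
apply: padic_abs_ultra_lt; last by rewrite ltrDl.
by rewrite (lt_le_trans (uN _ _ Nn (leqnn N))) // lerDr padic_abs_ge0.
Qed.

Lemma padic_cauchy_subring p : subring_closed (padic_cauchyb p).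
Proof.
split.
- apply/asboolP => e e0; exists 0%N => m n _ _.
  by rewrite (_ : _ - _ = 0) ?padic_abs0 //; exact: subrr.
- move=> u v /asboolP uC /asboolP vC; apply/asboolP => e e0.
  have [[M uM] [N vN]] := (uC e e0, vC e e0).
  exists (maxn M N) => m n; rewrite !geq_max => /andP[Mm Nm] /andP[Mn Nn].
  have -> : (u - v) m - (u - v) n = (u m - u n) - (v m - v n).
    by rewrite !opprD !opprK addrACA.
  by apply: padic_abs_ultra_lt; rewrite ?padic_absN; [exact: uM|exact: vN].
- move=> u v /asboolP uC /asboolP vC; apply/asboolP => e e0.
  have [B [M1 [B0 uB]]] := padic_cauchy_bounded uC.
  have [C [N1 [C0 vB]]] := padic_cauchy_bounded vC.
  have [M2 uM] := uC _ (divr_gt0 e0 C0); have [N2 vN] := vC _ (divr_gt0 e0 B0).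
  exists (maxn (maxn M1 M2) (maxn N1 N2)) => m n.
  rewrite !geq_max => /andP[/andP[M1m M2m] /andP[N1m N2m]].
  move=> /andP[/andP[M1n M2n] /andP[N1n N2n]].
  have -> : (u * v) m - (u * v) n = u m * (v m - v n) + (u m - u n) * v n.
    by rewrite mulrBr mulrBl addrA subrK.
  apply: padic_abs_ultra_lt; rewrite padic_absM.
    rewrite -(divfK (lt0r_neq0 B0) e) mulrC.
    by apply: ltr_pM; rewrite ?padic_abs_ge0 ?vN ?uB.
  rewrite -(divfK (lt0r_neq0 C0) e).
  by apply: ltr_pM; rewrite ?padic_abs_ge0 ?uM ?vB.
Qed.

HB.instance Definition _ p :=
  GRing.isSubringClosed.Build (nat -> rat) (padic_cauchyb p)
    (padic_cauchy_subring p).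

Record padic_cauchy_seq (p : nat) := PadicCauchySeq {
  padic_seq :> nat -> rat;
  _ : padic_seq \in padic_cauchyb p }.

HB.instance Definition _ p := [isSub for @padic_seq p].
HB.instance Definition _ p := [Choice of padic_cauchy_seq p by <:].
HB.instance Definition _ p :=
  [SubChoice_isSubComNzRing of padic_cauchy_seq p by <:].

Lemma padic_seqP p (u : padic_cauchy_seq p) : padic_cauchy p u.
Proof. by case: u => u /= /asboolP. Qed.

Definition padic_null (p : nat) (u : padic_cauchy_seq p) : Prop :=
  forall e : rat, 0 < e -> exists N : nat, forall n : nat,
    (N <= n)%N -> padic_abs p (u n) < e.

Definition padic_nullb (p : nat) : pred (padic_cauchy_seq p) :=
  fun u => `[< padic_null u >].

Lemma padic_null_idealr p : idealr_closed (padic_nullb (p := p)).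
Proof.
split.
- by apply/asboolP => e e0; exists 0%N => n _; rewrite padic_abs0.
- apply/asboolP => /(_ 1 ltr01)[N /(_ N (leqnn N))].
  by rewrite padic_abs1 ltxx.
- move=> a u v /asboolP u0 /asboolP v0; apply/asboolP => e e0.
  have [B [L [B0 aB]]] := padic_cauchy_bounded (padic_seqP a).
  have [[M uM] [N vN]] := (u0 _ (divr_gt0 e0 B0), v0 e e0).
  exists (maxn L (maxn M N)) => n; rewrite !geq_max => /and3P[Ln Mn Nn].
  apply: padic_abs_ultra_lt; last exact: vN.
  rewrite padic_absM -(divfK (lt0r_neq0 B0) e) mulrC.
  by apply: ltr_pM; rewrite ?padic_abs_ge0 ?uM ?aB.
Qed.

HB.instance Definition _ p :=
  isIdealr.Build (padic_cauchy_seq p) (@padic_nullb p) (padic_null_idealr p).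

Definition padic_null_ideal p : idealr (padic_cauchy_seq p) :=
  [the idealr (padic_cauchy_seq p) of @padic_nullb p].

(* Completion of [rat] for [padic_abs p]: Cauchy sequences modulo null ones.
   Below, [Qp p] is shown to be a field and a complete metric space in which
   [rat], embedded by [ratr], is dense with [padic_abs p] as induced norm. *)
Definition Qp (p : nat) : Type := {ideal_quot (padic_null_ideal p)}.

HB.instance Definition _ p := GRing.ComNzRing.on (Qp p).
HB.instance Definition _ p := EqQuotient.on (Qp p).
HB.instance Definition _ p := ZmodQuotient.on (Qp p).
HB.instance Definition _ p := NzRingQuotient.on (Qp p).

Lemma Qp_eqP p (u v : padic_cauchy_seq p) :
  reflect (padic_null (u - v)) (\pi_(Qp p) u == \pi_(Qp p) v).
Proof.
by rewrite -[_ == _](Quotient.idealrBE (padic_null_ideal p)); exact: asboolP.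
Qed.

Lemma padic_not_null_stable p (u : padic_cauchy_seq p) : ~ padic_null u ->
  exists N, forall n, (N <= n)%N ->
    u n != 0 /\ padic_abs p (u n) = padic_abs p (u N).
Proof.
move=> /existsNP[e /not_implyP[e0 /forallNP u0]].
have [N uN] := padic_seqP u e0.
have [n0 /not_implyP[Nn0 /negP]] := (existsNP _).2 (u0 N).
rewrite -leNgt => eu.
have uE n : (N <= n)%N -> padic_abs p (u n) = padic_abs p (u n0).
  by move=> Nn; apply: padic_abs_isosceles; exact: lt_le_trans (uN _ _ Nn Nn0) eu.
exists N => n Nn; split; last by rewrite !uE.
by rewrite -(padic_abs_eq0 p) uE // gt_eqF // (lt_le_trans e0).
Qed.

Lemma padic_cauchy_inv p (u : padic_cauchy_seq p) : ~ padic_null u ->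
  padic_cauchy p (fun n => (u n)^-1).
Proof.
move=> /padic_not_null_stable[N uN] e e0.
set c := padic_abs p (u N).
have c0 : 0 < c by rewrite padic_abs_gt0 //; case: (uN N (leqnn N)).
have [M uM] := padic_seqP u (mulr_gt0 e0 (mulr_gt0 c0 c0)).
exists (maxn M N) => m n; rewrite !geq_max => /andP[Mm Nm] /andP[Mn Nn].
have [[um0 umE] [un0 unE]] := (uN _ Nm, uN _ Nn).
have -> : (u m)^-1 - (u n)^-1 = (u n - u m) / (u m * u n).
  by rewrite invfM mulrBl mulrCA divff // mulr1 mulVKf.
rewrite padic_absM padic_absV padic_absM umE unE -/c.
by rewrite ltr_pdivrMr ?mulr_gt0 // uM.
Qed.

Definition Qp_inv (p : nat) (x : Qp p) : Qp p :=
  if x == 0 then 0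
  else \pi_(Qp p) (insubd (0 : padic_cauchy_seq p) (fun n => (repr x n)^-1)).

Lemma Qp_inv0 p : Qp_inv (0 : Qp p) = 0.
Proof. by rewrite /Qp_inv eqxx. Qed.

Lemma Qp_neq0_repr p (x : Qp p) : x != 0 -> ~ padic_null (repr x).
Proof.
move=> x0 xn; move: x0; rewrite -(reprK x) -(rmorph0 \pi_(Qp p)).
by move=> /negP; apply; apply/Qp_eqP; rewrite subr0.
Qed.

Lemma Qp_mulVf p (x : Qp p) : x != 0 -> Qp_inv x * x = 1.
Proof.
move=> x0; rewrite /Qp_inv (negPf x0) -{2}(reprK x).
rewrite -(rmorphM \pi_(Qp p)) -(rmorph1 \pi_(Qp p)).
have xn := Qp_neq0_repr x0.
apply/eqP/Qp_eqP => e e0; have [N uN] := padic_not_null_stable xn.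
exists N => n Nn; have [un0 _] := uN n Nn.
set v := insubd _ _.
have vE : v n = (repr x n)^-1.
  by rewrite /v val_insubd ifT //; apply/asboolP; exact: padic_cauchy_inv.
have -> : (v * repr x - 1) n = v n * repr x n - 1 by [].
by rewrite vE mulVf // subrr padic_abs0.
Qed.

HB.instance Definition _ p :=
  GRing.ComNzRing_isField.Build (Qp p) (@Qp_mulVf p) (@Qp_inv0 p).

Definition Qp_abs (p : nat) (x : Qp p) : rat :=
  lim ((padic_abs p (repr x n) : rat^o) @[n --> \oo]).

Lemma Qp_abs_null p (x : Qp p) : padic_null (repr x) -> Qp_abs x = 0.
Proof.
move=> x0; rewrite /Qp_abs. apply: (@cvg_lim rat^o); first exact: norm_hausdorff.
apply/cvgr0Pnorm_lt => e e0; have [N xN] := x0 e e0.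
by exists N => // n /= Nn; rewrite ger0_norm ?padic_abs_ge0 ?xN.
Qed.

Lemma Qp_abs_stable p (x : Qp p) : ~ padic_null (repr x) ->
  exists N, forall n, (N <= n)%N -> padic_abs p (repr x n) = Qp_abs x.
Proof.
move=> /padic_not_null_stable[N xN]; exists N => n Nn.
rewrite (xN n Nn).2; apply/esym/(@cvg_lim rat^o); first exact: norm_hausdorff.
apply: cvg_near_cst; exists N => // m /= Nm; exact: (xN m Nm).2.
Qed.

(* "Eventually [< e]" for a representative is the same as [< e] in the limit,
   the absolute values being eventually constant unless the limit is 0. *)
Lemma Qp_abs_pi_lt p (u : padic_cauchy_seq p) e : 0 < e ->
  Qp_abs (\pi_(Qp p) u) < e <->
  exists N, forall n, (N <= n)%N -> padic_abs p (u n) < e.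
Proof.
move=> e0; set x := \pi_(Qp p) u.
have /Qp_eqP/(_ e e0)[M uM] : \pi_(Qp p) (repr x) == \pi_(Qp p) u.
  by rewrite reprK.
have uMB n : (M <= n)%N -> padic_abs p (repr x n - u n) < e by move/uM.
have H : (exists N, forall n, (N <= n)%N -> padic_abs p (repr x n) < e) <->
    exists N, forall n, (N <= n)%N -> padic_abs p (u n) < e.
  split=> -[N H]; exists (maxn M N) => n; rewrite geq_max => /andP[Mn Nn].
    rewrite -(subKr (repr x n) (u n)); apply: padic_abs_ultra_lt; first exact: H.
    by rewrite padic_absN uMB.
  by rewrite -(subrK (u n) (repr x n)); apply: padic_abs_ultra_lt;
     [exact: uMB|exact: H].
rewrite -H; have [xn|xn] := pselect (padic_null (repr x)).
  by rewrite Qp_abs_null //; split=> // _; exact: xn.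
have [N xN] := Qp_abs_stable xn; split=> [xe|[K xK]].
  by exists N => n /xN ->.
by rewrite -(xN (maxn K N)) ?leq_maxr // xK ?leq_maxl.
Qed.

Lemma Qp_abs_ge0 p (x : Qp p) : 0 <= Qp_abs x.
Proof.
have [xn|xn] := pselect (padic_null (repr x)); first by rewrite Qp_abs_null.
by have [N /(_ N (leqnn N)) <-] := Qp_abs_stable xn; exact: padic_abs_ge0.
Qed.

Lemma Qp_abs_ultra_lt p (x y : Qp p) e :
  Qp_abs x < e -> Qp_abs y < e -> Qp_abs (x + y) < e.
Proof.
move=> xe ye; have e0 := le_lt_trans (Qp_abs_ge0 x) xe.
move: xe ye; rewrite -(reprK x) -(reprK y) -(rmorphD \pi_(Qp p)).
move=> /(Qp_abs_pi_lt _ e0)[M xM] /(Qp_abs_pi_lt _ e0)[N yN].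
apply/(Qp_abs_pi_lt _ e0); exists (maxn M N) => n.
rewrite geq_max => /andP[Mn Nn].
by apply: padic_abs_ultra_lt; [exact: xM|exact: yN].
Qed.

Lemma Qp_absN p (x : Qp p) : Qp_abs (- x) = Qp_abs x.
Proof.
have le (y : Qp p) : Qp_abs (- y) <= Qp_abs y.
  apply/ler_addgt0Pr => e e0; apply/ltW.
  have e1 : 0 < Qp_abs y + e by rewrite ltr_wpDl ?Qp_abs_ge0.
  have : Qp_abs y < Qp_abs y + e by rewrite ltrDl.
  move: (Qp_abs y + e) e1 => d d0; rewrite -(reprK y) -(rmorphN \pi_(Qp p)).
  move=> /(Qp_abs_pi_lt _ d0)[N yN]; apply/(Qp_abs_pi_lt _ d0).
  by exists N => n /yN; rewrite -padic_absN.
by apply/eqP; rewrite eq_le le /= -{1}(opprK x) le.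
Qed.

Lemma Qp_abs0 p : Qp_abs (0 : Qp p) = 0.
Proof.
apply/eqP; rewrite eq_le Qp_abs_ge0 andbT; apply/ler_addgt0Pr => e e0.
rewrite add0r ltW // -(rmorph0 \pi_(Qp p)); apply/(Qp_abs_pi_lt _ e0).
by exists 0%N => n _; rewrite padic_abs0.
Qed.

Lemma Qp_abs_eq0 p (x : Qp p) : Qp_abs x = 0 -> x = 0.
Proof.
move=> x0; apply/eqP/negPn/negP => /Qp_neq0_repr; apply => e e0.
by apply/(Qp_abs_pi_lt _ e0); rewrite reprK x0.
Qed.

Definition Qp_dist (p : nat) (x y : Qp p) : rat := Qp_abs (x - y).

Lemma Qp_distxx p (x : Qp p) : Qp_dist x x = 0.
Proof. by rewrite /Qp_dist subrr Qp_abs0. Qed.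

Lemma Qp_dist_positivity p (x y : Qp p) : Qp_dist x y = 0 -> x = y.
Proof. by move=> /Qp_abs_eq0/eqP; rewrite subr_eq0 => /eqP. Qed.

Lemma Qp_dist_sym p (x y : Qp p) : Qp_dist x y = Qp_dist y x.
Proof. by rewrite /Qp_dist -opprB Qp_absN. Qed.

Lemma Qp_dist_triangle p (y x z : Qp p) :
  Qp_dist x z <= Qp_dist x y + Qp_dist y z.
Proof.
apply/ler_addgt0Pr => e e0; rewrite /Qp_dist -(subrK y x) -addrA ltW //.
apply: Qp_abs_ultra_lt; rewrite subrK.
  by rewrite -addrA ltrDl ltr_wpDl ?Qp_abs_ge0.
by rewrite addrAC ltrDr ltr_wpDl ?Qp_abs_ge0.
Qed.

HB.instance Definition _ p := isMetric.Build rat (Qp p) (@Qp_distxx p)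
  (@Qp_dist_positivity p) (@Qp_dist_sym p) (@Qp_dist_triangle p).
HB.instance Definition _ p := isPointed.Build (Qp p) 0.

Lemma padic_cauchy_cst p (q : rat) : (fun=> q) \in padic_cauchyb p.
Proof. by apply/asboolP => e e0; exists 0%N => *; rewrite subrr padic_abs0. Qed.

Definition padic_cst (p : nat) (q : rat) : padic_cauchy_seq p :=
  PadicCauchySeq (padic_cauchy_cst p q).

Lemma padic_seq_int p (z : int) n : (z%:~R : padic_cauchy_seq p) n = z%:~R.
Proof.
have natE k : (k%:R : padic_cauchy_seq p) n = k%:R.
  by elim: k => [//|k IHk]; rewrite !mulrS -IHk.
by case: z => k; rewrite ?NegzE ?mulrNz -?pmulrn -natE.
Qed.

Lemma Qp_ratrE p (q : rat) : ratr q = \pi_(Qp p) (padic_cst p q).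
Proof.
have d0 : (denq q)%:~R != 0 :> Qp p.
  rewrite -(rmorph_int \pi_(Qp p)) -(rmorph0 \pi_(Qp p)).
  have a0 : 0 < padic_abs p (denq q)%:~R.
    by rewrite padic_abs_gt0 // intr_eq0 denq_neq0.
  apply/negP => /Qp_eqP; rewrite subr0 => /(_ _ a0)[N /(_ N (leqnn N))].
  by rewrite padic_seq_int ltxx.
apply: (mulIf d0); rewrite divfK // -!(rmorph_int \pi_(Qp p)) -rmorphM.
congr (\pi _); apply/val_inj/funext => n /=.
rewrite [LHS]padic_seq_int numqE.
by rewrite -(padic_seq_int p (denq q) n).
Qed.

Lemma Qp_abs_ratr p (q : rat) : Qp_abs (ratr q : Qp p) = padic_abs p q.
Proof.
have lt e : 0 < e -> (Qp_abs (ratr q : Qp p) < e) = (padic_abs p q < e).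
  move=> e0; rewrite Qp_ratrE; apply/idP/idP.
    by move=> /(Qp_abs_pi_lt _ e0)[N /(_ N (leqnn N))].
  by move=> qe; apply/(Qp_abs_pi_lt _ e0); exists 0%N.
apply/eqP; rewrite eq_le; apply/andP; split;
  apply/ler_addgt0Pr => e e0; apply/ltW.
  by rewrite lt ?ltrDl // ltr_wpDl ?padic_abs_ge0.
by rewrite -lt ?ltrDl // ltr_wpDl ?Qp_abs_ge0.
Qed.

Lemma Qp_ballP p (x y : Qp p) (e : rat) : ball x e y <-> Qp_dist x y < e.
Proof. by rewrite ballEmdist. Qed.

Lemma Qp_ratrB p (q r : rat) : ratr (q - r) = ratr q - ratr r :> Qp p.
Proof.
rewrite !Qp_ratrE -(rmorphB \pi_(Qp p)); congr (\pi _).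
by apply/val_inj/funext => n.
Qed.

Lemma Qp_approx p (x : Qp p) e : 0 < e -> exists q, Qp_dist x (ratr q) < e.
Proof.
move=> e0; have [N xN] := padic_seqP (repr x) e0.
exists (repr x N); rewrite /Qp_dist Qp_ratrE -{1}(reprK x) -(rmorphB \pi_(Qp p)).
by apply/(Qp_abs_pi_lt _ e0); exists N => n Nn; exact: xN.
Qed.

Lemma Qp_dense_rat p : dense (range (ratr : rat -> Qp p)).
Proof.
move=> U [x Ux] Uo; have /nbhs_ballP[e /= e0 eU] := open_nbhs_nbhs (conj Uo Ux).
have [q xq] := Qp_approx x e0; exists (ratr q); split; last by exists q.
exact/eU/Qp_ballP.
Qed.

Lemma Qp_complete p (F : set_system (Qp p)) :
  ProperFilter F -> cauchy F -> cvg F.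
Proof.
move=> FF /cauchyP Fc.
have inv_gt0 n : 0 < n.+1%:R^-1 :> rat by rewrite invr_gt0 ltr0n.
have /choice[q qF] n : exists q, F (ball (ratr q : Qp p) n.+1%:R^-1).
  have [x xF] := Fc _ (inv_gt0 n); have [q xq] := Qp_approx x (inv_gt0 n).
  exists q; apply: filterS xF => y /Qp_ballP xy; apply/Qp_ballP.
  rewrite /Qp_dist -(subrK x (ratr q)) -addrA.
  by apply: Qp_abs_ultra_lt => //; rewrite -[Qp_abs _]Qp_dist_sym.
have qq m n e : m.+1%:R^-1 < e -> n.+1%:R^-1 < e -> padic_abs p (q m - q n) < e.
  move=> me ne.
  have [y [/Qp_ballP my /Qp_ballP ny]] := filter_ex (filterI (qF m) (qF n)).
  rewrite -(Qp_abs_ratr p) Qp_ratrB -(subrK y (ratr (q m))) -addrA.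
  apply: Qp_abs_ultra_lt; first exact: lt_trans me.
  by rewrite -[Qp_abs _]Qp_dist_sym; exact: lt_trans ne.
have small e : 0 < e -> exists N, forall n, (N <= n)%N -> n.+1%:R^-1 < e :> rat.
  move=> e0; exists (Num.bound e^-1) => n Nn.
  rewrite invf_plt ?posrE ?ltr0n //.
  apply: lt_le_trans (archi_boundP _) _; first by rewrite invr_ge0 ltW.
  by rewrite ler_nat (leq_trans Nn).
have qC : q \in padic_cauchyb p.
  apply/asboolP => e e0; have [N H] := small e e0.
  by exists N => m n Nm Nn; apply: qq; exact: H.
apply/cvg_ex; exists (\pi_(Qp p) (PadicCauchySeq qC)).
apply/fcvg_ballP => e e0; have [N H] := small e e0.
apply: filterS (qF N) => y /Qp_ballP Ny; apply/Qp_ballP.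
rewrite /Qp_dist -(subrK (ratr (q N)) (\pi_(Qp p) (PadicCauchySeq qC))) -addrA.
apply: Qp_abs_ultra_lt; last exact: lt_trans (H _ (leqnn N)).
rewrite Qp_ratrE -(rmorphB \pi_(Qp p)); apply/(Qp_abs_pi_lt _ e0).
by exists N => n Nn; apply: qq; exact: H.
Qed.

HB.instance Definition _ p := Uniform_isComplete.Build (Qp p) (@Qp_complete p).

Definition quotient_set (A : set int) : set rat :=
  [set a%:~R / b%:~R | a in A & b in A `&` [set b | b != 0]].

(* Main.v *)
(* The hypotheses make [a_k x_(n-k)] the strictly dominant term, for the p-adic
   absolute value, in the recurrence for [x_n]. Hence [|x_n| = |x_(n-k)|], so
   that all [|x_n|] lie in the finite set [{|x_0|, ..., |x_(k-1)|}] of positive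
   numbers, and the quotients stay away from 0. *)
Require Import Defs.
From mathcomp Require Import all_boot all_order all_algebra.
From mathcomp Require Import all_classical all_reals topology.

Import Order.TTheory GRing.Theory Num.Theory.

Local Open Scope classical_set_scope.
Local Open Scope ring_scope.

Lemma padic_abs_sum_lt (p : nat) (I : eqType) (r : seq I) (F : I -> rat)
    (e : rat) :
  0 < e -> (forall i, i \in r -> padic_abs p (F i) < e) ->
  padic_abs p (\sum_(i <- r) F i) < e.
Proof.
move=> e0 Fe; rewrite big_seq.
apply: (big_ind (fun s => padic_abs p s < e)) => // s t.
exact: padic_abs_ultra_lt.
Qed.

Lemma padic_abs_intE (p : nat) (z : int) : z != 0 ->
  padic_abs p z%:~R = p%:R ^- logn p `|z|.
Proof.
move=> z0; rewrite /padic_abs /padic_val intr_eq0 (negPf z0) numq_int denq_int.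
by rewrite logn1 subr0 -exprnN.
Qed.

Lemma padic_abs_int_le1 (p : nat) (z : int) : prime p ->
  padic_abs p z%:~R <= 1.
Proof.
move=> pp; have [->|z0] := eqVneq z 0; first by rewrite mulr0z padic_abs0.
rewrite padic_abs_intE // invf_le1 ?exprn_gt0 ?ltr0n ?prime_gt0 //.
by rewrite exprn_ege1 // ler1n prime_gt0.
Qed.

Lemma padic_abs_int_eq1 (p : nat) (z : int) : ~~ (p%:Z %| z)%Z ->
  padic_abs p z%:~R = 1.
Proof.
rewrite dvdzE /= => pz.
have z0 : z != 0 by apply: contraNneq pz => ->; rewrite absz0 dvdn0.
by rewrite padic_abs_intE // lognE (negPf pz) !andbF expr0 invr1.
Qed.

(** This carries the hypothesis on valuations over to absolute values: [t -> p^(-t)] reverses strict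
    inequalities since [p > 1]. Nonzero [q] and [r] keep the difference finite; an infinite
    valuation of [s] means [s = 0], and then the product vanishes. *)
Lemma padic_absM_lt (p : nat) (q r s : rat) : prime p -> q != 0 -> r != 0 ->
  (padic_val p q - padic_val p r < padic_val p s)%E ->
  padic_abs p s * padic_abs p r < padic_abs p q.
Proof.
move=> pp q0 r0; have [->|s0] := eqVneq s 0.
  by rewrite padic_abs0 mul0r padic_abs_gt0.
rewrite /padic_abs /padic_val (negPf q0) (negPf r0) (negPf s0) -EFinB lte_fin.
move=> lt; rewrite -expfzDr ?pnatr_eq0 -?lt0n ?prime_gt0 //.
by rewrite ltr_eXz2l ?ltr1n ?prime_gt1 // -opprD ltrN2 -ltrBlDr.
Qed.

Lemma padic_abs_dominant (p : nat) (q r : rat) :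
  padic_abs p q < padic_abs p r -> padic_abs p (q + r) = padic_abs p r.
Proof. by move=> qr; apply: padic_abs_isosceles; rewrite addrK. Qed.

(** Strong induction. The conclusion refers to an initial term rather than to [x (n - k)] because
    the strict bound is assumed on initial values only; it thus extends to every [x (n - j)] in the
    recurrence. *)
Lemma padic_abs_linrec (p k : nat) (a x : nat -> int) : (0 < k)%N ->
  (forall n, (k <= n)%N -> x n = \sum_(1 <= j < k.+1) a j * x (n - j)%N) ->
  padic_abs p (a k)%:~R = 1 ->
  (forall i, (i < k)%N -> x i != 0) ->
  (forall j m n, (0 < j < k)%N -> (m < k)%N -> (n < k)%N ->
    padic_abs p (a j)%:~R * padic_abs p (x n)%:~R < padic_abs p (x m)%:~R) ->
  forall n, exists2 i, (i < k)%N & padic_abs p (x n)%:~R = padic_abs p (x i)%:~R.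
Proof.
move=> k0 xE ak x0 ax; elim/ltn_ind => n IHn.
have [nk|kn] := ltnP n k; first by exists n.
have n0 := leq_trans k0 kn.
have [i ik xi] : exists2 i, (i < k)%N &
    padic_abs p (x (n - k)%N)%:~R = padic_abs p (x i)%:~R.
  by apply: IHn; rewrite ltn_subrL k0.
(* The term [j = k] is split off; it dominates the rest of the sum. *)
exists i => //; rewrite -xi xE // big_nat_recr //= intrD.
have akx : padic_abs p (a k * x (n - k)%N)%:~R = padic_abs p (x i)%:~R.
  by rewrite intrM padic_absM ak mul1r.
rewrite padic_abs_dominant akx // rmorph_sum.
apply: padic_abs_sum_lt => [|j].
  by rewrite padic_abs_gt0 // intr_eq0 x0.
rewrite mem_index_iota => jk /=; rewrite intrM padic_absM.
have [l lk ->] : exists2 l, (l < k)%N &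
    padic_abs p (x (n - j)%N)%:~R = padic_abs p (x l)%:~R.
  by apply: IHn; case/andP: jk => j0 _; rewrite ltn_subrL j0.
exact: ax.
Qed.

Lemma padic_not_dense_away0 (p : nat) (A : set rat) (e : rat) : 0 < e ->
  (forall q, A q -> e <= padic_abs p q) ->
  ~ dense [set (ratr q : Qp p) | q in A].
Proof.
(* The ball of radius [e] about 0 contains no [ratr q] with [q] in [A]. Passing to its interior
   gives an open set that still contains 0. *)
move=> e0 Ae /(_ (interior (ball (0 : Qp p) e))) []; last 2 first.
- exact: open_interior.
- move=> y [/interior_subset/Qp_ballP + [q Aq qy]].
  by rewrite -qy Qp_dist_sym /Qp_dist subr0 Qp_abs_ratr ltNge Ae.
- by exists 0; exact: nbhsx_ballx.
Qed.

Theorem theorem1p8 (k : nat) (hk : (2 <= k)%N) (a x : nat -> int)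
  (hrec : forall n : nat, (k <= n)%N ->
     x n = \sum_(1 <= j < k.+1) a j * x (n - j)%N)
  (p : nat) (hp : prime p) (hak : ~~ (p%:Z %| a k)%Z)
  (hx0 : forall i : nat, (i < k)%N -> x i != 0)
  (hval : (\big[Order.min/+oo]_(1 <= j < k) padic_val p (a j)%:~R >
           \big[Order.max/-oo]_(m < k) \big[Order.max/-oo]_(n < k)
             (padic_val p (x m)%:~R - padic_val p (x n)%:~R))%E) :
  ~ dense [set (ratr q : Qp p) | q in quotient_set (range x)].
Proof.
have k0 : (0 < k)%N by exact: ltnW.
have ax j m n : (0 < j < k)%N -> (m < k)%N -> (n < k)%N ->
    padic_abs p (a j)%:~R * padic_abs p (x n)%:~R < padic_abs p (x m)%:~R.
  move=> jk mk nk; apply: padic_absM_lt; rewrite ?intr_eq0 ?hx0 //.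
  (* The minimum is at most its term at [j], the double maximum at least its term at [(m, n)]. *)
  apply: le_lt_trans (lt_le_trans hval _); last first.
    by apply: bigmin_inf_seq (lexx _); rewrite ?mem_index_iota.
  apply: le_trans (le_bigmax _ _ (Ordinal mk)).
  exact: le_trans (le_bigmax _ _ (Ordinal nk)).
have xabs := padic_abs_linrec _ _ _ _ k0 hrec (padic_abs_int_eq1 _ _ hak) hx0 ax.
(* The default value 1 is harmless: [e] only has to be positive and at most each initial absolute
   value. *)
pose e : rat := \big[Order.min/1]_(i < k) padic_abs p (x i)%:~R.
have e0 : 0 < e.
  by apply: lt_bigmin => // i _; rewrite padic_abs_gt0 // intr_eq0 hx0.
apply: (padic_not_dense_away0 _ _ _ e0) => _ [_ [m _ <-] [_ [[n _ <-] /= xn0] <-]].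
(* [|x_n| <= 1], so dividing by [x_n] does not decrease the absolute value *)
rewrite padic_absM padic_absV.
apply: (@le_trans _ _ (padic_abs p (x m)%:~R)).
  have [i ik ->] := xabs m; exact: (bigmin_le _ (Ordinal ik)).
rewrite ler_peMr ?padic_abs_ge0 // invf_ge1 ?padic_abs_int_le1 //.
by rewrite padic_abs_gt0 ?intr_eq0.
Qed.
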